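(* For every integer $d\ge3$ there exists a $d$-dimensional integral polytope $\mathcal{P}$ such that the coefficient of $t^{d-2}$ in $i(\mathcal{P},t)$ is positive and the coefficient of $t^{j}$ in $i(\mathcal{P},t)$ is negative for all $1\le j<d-2$.
   Context: An integral polytope is a convex polytope all of whose vertices have integer coordinates. For an integral polytope $\mathcal{P}\subseteq\mathbb{R}^N$ of dimension $d$, $i(\mathcal{P},t)=|t\mathcal{P}\cap\mathbb{Z}^N|$ ($t$ a positive integer) is a polynomial in $t$ of degree $d$, the Ehrhart polynomial. *)

(* Defs.v *)
From HB Require Import structures.
From mathcomp Require Import all_boot all_order all_algebra.
From mathcomp Require Import finmap.
From mathcomp Require Import all_classical all_reals all_analysis.

Set Implicit Arguments.
Unset Strict Implicit.
Unset Printing Implicit Defensive.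
Import Order.TTheory GRing.Theory Num.Theory.
Local Open Scope classical_set_scope.
Local Open Scope ring_scope.

Definition convex_hull (R : realType) (N : nat) (A : set 'rV[R]_N) :
    set 'rV[R]_N :=
  smallest (fun C : set 'rV[R]_N => convex_set C) A.

Definition polytope (R : realType) (N : nat) (P : set 'rV[R]_N) : Prop :=
  exists s : seq 'rV[R]_N, P = convex_hull [set` s].

(* With c = 0 this also counts P itself and the empty set as faces. *)
Definition face (R : realType) (N : nat) (P F : set 'rV[R]_N) : Prop :=
  exists (c : 'rV[R]_N) (b : R),
    (forall x, P x -> \sum_(i < N) c ord0 i * x ord0 i <= b) /\
    F = P `&` [set x | \sum_(i < N) c ord0 i * x ord0 i = b].

Definition vertex (R : realType) (N : nat) (P : set 'rV[R]_N)
    (v : 'rV[R]_N) : Prop :=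
  face P [set v].

Definition integer_lattice (R : realType) (N : nat) : set 'rV[R]_N :=
  [set x | forall i, x ord0 i \is a Num.int].

Definition integral_polytope (R : realType) (N : nat) (P : set 'rV[R]_N) :
    Prop :=
  polytope P /\ vertex P `<=` @integer_lattice R N.

Definition affine_set (R : realType) (N : nat) (A : set 'rV[R]_N) : Prop :=
  forall (x y : 'rV[R]_N) (t : R), A x -> A y -> A ((1 - t) *: x + t *: y).

Definition affine_hull (R : realType) (N : nat) (A : set 'rV[R]_N) :
    set 'rV[R]_N :=
  smallest (@affine_set R N) A.

(* A relation rather than a function: the empty set has no dimension. *)
Definition has_dimension (R : realType) (N : nat) (P : set 'rV[R]_N)
    (d : nat) : Prop :=
  exists (x : 'rV[R]_N) (V : {vspace 'rV[R]_N}),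
    affine_hull P = [set x + v | v in [set` V]] /\ \dim V = d.

(* [fset_set] sends infinite sets to the empty one, but a dilated polytope is
   bounded and so meets the integer lattice in a finite set. *)
Definition ehrhart (R : realType) (N : nat) (P : set 'rV[R]_N) (t : nat) :
    nat :=
  #|` fset_set ([set t%:R *: x | x in P] `&` @integer_lattice R N)|.

(* At most one polynomial satisfies this, since it prescribes the values at
   infinitely many points. *)
Definition ehrhart_polynomial (R : realType) (N : nat) (P : set 'rV[R]_N)
    (p : {poly R}) : Prop :=
  forall t : nat, (0 < t)%N -> p.[t%:R] = (ehrhart P t)%:R.

(* Main.v *)
(** The polytope is a product of a dilated Reeve tetrahedron
    [conv {0, k e_1, k e_2, k (1, 1, m)}] and a cube [[0, n]^N], with
    [N = d - 3], so its Ehrhart polynomial is the product of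
    [1 + k (2 - m/6) t + k^2 t^2 + k^3 (m/6) t^3] and [(1 + n t)^N].  For
    large [m] the first factor is close to a multiple of [u^3 - u], where
    [u = k t], and [(1 + n t)^N] to one of [(u + k/n)^N]: multiplying by
    [-u] makes the low coefficients negative as soon as [m] dominates
    [(n/k) N], whereas the coefficient of [t^(d-2)] becomes positive once
    [k/n] is somewhat larger than [sqrt 2 / N].  For [d > 3] the choice [k = 2],
    [n = N], [m = 72 N^2 - 54] works, including the tight case [N = 1], where
    exactly the [m] with [15 < m < 24] do; for [d = 3] the unimodular
    tetrahedron suffices. *)

Require Import Defs.
From HB Require Import structures.
From mathcomp Require Import all_boot all_order all_algebra.
From mathcomp Require Import all_classical all_reals all_analysis.
From mathcomp Require Import finmap zify ring lra.

Import Order.TTheory GRing.Theory Num.Theory.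
Local Open Scope ring_scope.

Set Implicit Arguments.
Unset Strict Implicit.
Unset Printing Implicit Defensive.
Local Open Scope classical_set_scope.

(** * Lattice polytopes and their products *)

Lemma convex_setE (R : realType) (N : nat) (C : set 'rV[R]_N) :
  convex_set C <-> forall (x y : 'rV[R]_N) (t : R), 0 <= t <= 1 ->
    C x -> C y -> C (t *: x + (1 - t) *: y).
Proof.
split=> [cC x y t t01 Cx Cy|cC x y t].
  have [t0 t1] := andP t01.
  exact: (set_mem (cC x y (Itv01 t0 t1) (mem_set Cx) (mem_set Cy))).
move=> /set_mem Cx /set_mem Cy; apply/mem_set.
by apply: cC => //; apply/andP; split.
Qed.

Lemma convex_hull_convex (R : realType) (N : nat) (A : set 'rV[R]_N) :
  convex_set (convex_hull A).
Proof.
apply/convex_setE => x y t t01 Ax Ay C [cC AC].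
have /convex_setE := cC; apply => //; [exact: Ax|exact: Ay].
Qed.

Lemma convex_open_halfspace (R : realType) (N : nat) (c : 'rV[R]_N) (b : R) :
  convex_set [set x : 'rV[R]_N | \sum_(i < N) c ord0 i * x ord0 i < b].
Proof.
apply/convex_setE => x y t /andP[t0 t1] /= xb yb.
under eq_bigr do rewrite !mxE mulrDr mulrCA [X in _ + X]mulrCA.
rewrite big_split /= -!mulr_sumr.
(* The strict bound at [x] counts only if its weight [t] is nonzero; at [t = 0] the bound at [y] is
   used. *)
have [->|tn0] := eqVneq t 0; first by lra.
have : 0 < t * (b - \sum_(i < N) c ord0 i * x ord0 i).
  by rewrite mulr_gt0 ?subr_gt0 // lt_neqAle eq_sym tn0.
have : 0 <= (1 - t) * (b - \sum_(i < N) c ord0 i * y ord0 i).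
  by rewrite mulr_ge0 // subr_ge0 // ltW.
lra.
Qed.

(** A generator on the supporting hyperplane of [v] lies in the face, hence equals [v]. If [v] were
    no generator, all generators would lie in the open half-space, which is convex and so would
    contain the hull and [v] itself. *)
Lemma vertex_convex_hull (R : realType) (N : nat) (A : set 'rV[R]_N) :
  vertex (convex_hull A) `<=` A.
Proof.
move=> v [c [b [le_b vE]]]; apply: contrapT => nAv.
have /= [Pv vb] : (convex_hull A `&`
    [set x | \sum_(i < N) c ord0 i * x ord0 i = b]) v by rewrite -vE.
suff : \sum_(i < N) c ord0 i * v ord0 i < b by rewrite vb ltxx.
have AP := @sub_gen_smallest _ (@convex_set R _) A.
apply: (smallest_sub (convex_open_halfspace (c := c) (b := b)) _ Pv) => a Aa /=.
rewrite lt_neqAle le_b ?andbT; last exact: AP.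
apply/eqP => ab; apply: nAv; suff <- : a = v by [].
have : (convex_hull A `&` [set x | \sum_(i < N) c ord0 i * x ord0 i = b]) a.
  by split => //; exact: AP.
by rewrite -vE.
Qed.

Definition lattice_points (R : realType) (N : nat) (P : set 'rV[R]_N)
    (t : nat) : set 'rV[R]_N :=
  [set t%:R *: x | x in P] `&` @integer_lattice R N.

(* The enumeration makes the finiteness of the sets of lattice points explicit,
   which is what lets their cardinals multiply. *)
Definition full_lattice_polytope (R : realType) (N : nat) (P : set 'rV[R]_N)
    (f : nat -> nat) : Prop :=
  [/\ exists2 s : seq 'rV[R]_N, P = convex_hull [set` s] &
        forall v, v \in s -> integer_lattice v,
      affine_hull P = setT &
      forall t, (0 < t)%N -> exists s : seq 'rV[R]_N,
        [/\ uniq s, size s = f t & lattice_points P t = [set` s]]].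

Lemma full_lattice_polytopeP (R : realType) (N : nat) (P : set 'rV[R]_N)
    (f : nat -> nat) :
  full_lattice_polytope P f ->
  [/\ integral_polytope P, has_dimension P N &
      forall t, (0 < t)%N -> ehrhart P t = f t].
Proof.
move=> [[s -> s_int] affP countP]; split.
- by split; [exists s | move=> v /vertex_convex_hull /= /s_int].
- exists 0, fullv; split; last by rewrite dimvf /dim /= mul1n.
  rewrite affP; apply/seteqP; split=> // x _.
  by exists x; rewrite ?add0r //= memvf.
- move=> t /countP [u [uniq_u <- uE]].
  rewrite /ehrhart -/(lattice_points _ t) uE.
  suff -> : fset_set [set` u] = [fset x in u]%fset.
    by rewrite card_fseq undup_id.
  apply/fsetP => x; rewrite in_fset_set; last exact: finite_seq.
  by rewrite in_fset /=; apply/idP/idP => [/set_mem|xu] //; apply/mem_set.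
Qed.

Lemma affine_hull_setT (R : realType) (N : nat) (P : set 'rV[R]_N) :
  affine_hull P = setT <->
  forall C : set 'rV[R]_N, affine_set C -> P `<=` C -> C = setT.
Proof.
split=> [PT C aC PC|PT].
  apply/seteqP; split=> // x _.
  by have : affine_hull P x by [rewrite PT]; apply.
by apply/seteqP; split=> // x _ C [aC PC]; rewrite (PT C).
Qed.

(** * Products of polytopes *)

Definition product_set (R : realType) (M N : nat) (P : set 'rV[R]_M)
    (Q : set 'rV[R]_N) : set 'rV[R]_(M + N) :=
  [set z | P (lsubmx z) /\ Q (rsubmx z)].

(** Slicing, one factor at a time: if a convex [C] contains all [row_mx x y], its slice at a
    generator [y] is convex and contains [s], hence the first hull; so its slice at any [x] of that
    hull contains [u], hence the second hull. *)
Lemma convex_hull_product (R : realType) (M N : nat) (s : seq 'rV[R]_M)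
    (u : seq 'rV[R]_N) :
  product_set (convex_hull [set` s]) (convex_hull [set` u]) =
  convex_hull [set` [seq row_mx x y | x <- s, y <- u]].
Proof.
apply/seteqP; split=> [z [sz uz]|].
  rewrite -(hsubmxK z) => C [/convex_setE cC suC].
  pose D (y : 'rV[R]_N) : set 'rV[R]_M := [set x | C (row_mx x y)].
  have sD y : y \in u -> convex_hull [set` s] `<=` D y.
    move=> yu x sx; apply: sx; split=> [|v vs].
      apply/convex_setE => a b t t01 Da Db; rewrite /D /=.
      have -> : y = t *: y + (1 - t) *: y by rewrite -scalerDl subrKC scale1r.
      by rewrite -add_row_mx -!scale_row_mx; apply: cC.
    by apply: suC; apply: allpairs_f.
  apply: (uz [set y | C (row_mx (lsubmx z) y)]); split=> [|y yu]; last exact: sD.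
  apply/convex_setE => a b t t01 Da Db /=.
  have -> : lsubmx z = t *: lsubmx z + (1 - t) *: lsubmx z.
    by rewrite -scalerDl subrKC scale1r.
  by rewrite -add_row_mx -!scale_row_mx; apply: cC.
apply: smallest_sub.
  apply/convex_setE => a b t t01 [sa ua] [sb ub].
  have cs := iffLR (convex_setE _) (@convex_hull_convex R M [set` s]).
  have cu := iffLR (convex_setE _) (@convex_hull_convex R N [set` u]).
  by split; rewrite linearD !linearZ; [apply: cs|apply: cu].
move=> _ /= /allpairsP[[x y] [/= xs yu ->]]; split.
  by rewrite row_mxKl; apply: sub_gen_smallest.
by rewrite row_mxKr; apply: sub_gen_smallest.
Qed.

Lemma affine_hull_product (R : realType) (M N : nat) (P : set 'rV[R]_M)
    (Q : set 'rV[R]_N) :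
  affine_hull P = setT -> affine_hull Q = setT ->
  affine_hull (product_set P Q) = setT.
Proof.
move=> /affine_hull_setT aP /affine_hull_setT aQ; apply/affine_hull_setT.
move=> C aC PQC; apply/seteqP; split=> // z _; rewrite -(hsubmxK z).
have PC y : Q y -> [set x | C (row_mx x y)] = setT.
  move=> Qy; apply: aP => [a b t /= Da Db|x Px].
    have -> : y = (1 - t) *: y + t *: y by rewrite -scalerDl subrK scale1r.
    by rewrite -add_row_mx -!scale_row_mx; apply: aC.
  by apply: PQC; rewrite /product_set /= row_mxKl row_mxKr.
suff CT : [set y | C (row_mx (lsubmx z) y)] = setT.
  by have : [set y | C (row_mx (lsubmx z) y)] (rsubmx z) by [rewrite CT].
apply: aQ => [a b t /= Da Db|y Qy].
  have -> : lsubmx z = (1 - t) *: lsubmx z + t *: lsubmx z.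
    by rewrite -scalerDl subrK scale1r.
  by rewrite -add_row_mx -!scale_row_mx; apply: aC.
by have : [set x | C (row_mx x y)] (lsubmx z) by [rewrite PC].
Qed.

(** Dilation and integrality are both coordinatewise; this is why the counts multiply. *)
Lemma lattice_points_product (R : realType) (M N : nat) (P : set 'rV[R]_M)
    (Q : set 'rV[R]_N) (t : nat) :
  lattice_points (product_set P Q) t =
  product_set (lattice_points P t) (lattice_points Q t).
Proof.
apply/seteqP; split=> z.
  move=> [[w [Pw Qw] <-{z}] zint]; split; split=> //=.
  - by exists (lsubmx w); rewrite // linearZ.
  - by move=> i; rewrite mxE; apply: zint.
  - by exists (rsubmx w); rewrite // linearZ.
  - by move=> i; rewrite mxE; apply: zint.
move=> [[[x Px xE] lint] [[y Qy yE] rint]]; split.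
  exists (row_mx x y); last by rewrite scale_row_mx xE yE hsubmxK.
  by rewrite /product_set /= row_mxKl row_mxKr.
move=> i; rewrite -(hsubmxK z) mxE; case: splitP => j _; [exact: lint|exact: rint].
Qed.

Lemma full_lattice_polytope_product (R : realType) (M N : nat)
    (P : set 'rV[R]_M) (Q : set 'rV[R]_N) (f g : nat -> nat) :
  full_lattice_polytope P f -> full_lattice_polytope Q g ->
  full_lattice_polytope (product_set P Q) (fun t => f t * g t)%N.
Proof.
move=> [[s -> sint] affP cP] [[u -> uint] affQ cQ]; split.
- exists [seq row_mx x y | x <- s, y <- u]; first exact: convex_hull_product.
  move=> _ /allpairsP[[x y] [/= /sint xint /uint yint ->]] i.
  by rewrite mxE; case: splitP => j _.
- exact: affine_hull_product.
- move=> t t0; have [a [ua <- aE]] := cP t t0; have [b [ub <- bE]] := cQ t t0.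
  exists [seq row_mx x y | x <- a, y <- b]; split.
  + by apply: allpairs_uniq => // -[x y] [x' y'] _ _ /= /eq_row_mx[-> ->].
  + exact: size_allpairs.
  + rewrite lattice_points_product aE bE; apply/seteqP; split=> z /=.
      by move=> [za zb]; rewrite -(hsubmxK z); apply: allpairs_f.
    move=> /allpairsP[[x y] [/= xa yb ->]].
    by rewrite /product_set /= row_mxKl row_mxKr.
Qed.

Lemma convex_comb4 (R : realType) (N : nat) (C : set 'rV[R]_N)
    (x y z w : 'rV[R]_N) (a b c d : R) :
  convex_set C -> C x -> C y -> C z -> C w ->
  0 <= a -> 0 <= b -> 0 <= c -> 0 <= d -> a + b + (c + d) = 1 ->
  C (a *: x + b *: y + (c *: z + d *: w)).
Proof.
move=> /convex_setE cC Cx Cy Cz Cw a0 b0 c0 d0 abcd.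
have pair u v (e f : R) : C u -> C v -> 0 <= e -> 0 <= f ->
    exists2 p, C p & e *: u + f *: v = (e + f) *: p.
  move=> Cu Cv e0 f0; have [ef0|efN0] := eqVneq (e + f) 0.
    have -> : e = 0 by lra.
    have -> : f = 0 by lra.
    by exists u; rewrite ?addr0 ?scale0r ?addr0.
  have efp : 0 < e + f by rewrite lt_neqAle eq_sym efN0 addr_ge0.
  exists ((e / (e + f)) *: u + (1 - e / (e + f)) *: v).
    by apply: cC => //; rewrite divr_ge0 ?addr_ge0 //= ler_pdivrMr // mul1r lerDl.
  by rewrite scalerDr !scalerA; congr (_ *: _ + _ *: _); field.
have [p Cp ->] := pair x y a b Cx Cy a0 b0.
have [q Cq ->] := pair z w c d Cz Cw c0 d0.
have -> : c + d = 1 - (a + b) by lra.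
by apply: cC => //; lra.
Qed.

(** An affine set through the origin is a linear subspace: scaling is an affine combination with
    [0], and a sum is twice a midpoint. *)
Lemma affine_set_span (R : realType) (N : nat) (C : set 'rV[R]_N)
    (x y : 'rV[R]_N) (a b : R) :
  affine_set C -> C 0 -> C x -> C y -> C (a *: x + b *: y).
Proof.
move=> aC C0 Cx Cy.
have scaleC u (e : R) : C u -> C (e *: u).
  by move=> Cu; have := aC 0 u e C0 Cu; rewrite scaler0 add0r.
have -> : a *: x + b *: y =
    2 *: ((1 - 2^-1) *: (a *: x) + 2^-1 *: (b *: y)).
  by rewrite scalerDr !scalerA; congr (_ *: _ + _ *: _); field.
by apply/scaleC/aC; apply: scaleC.
Qed.

(** * Intervals and cubes *)

Lemma interval_polytope (R : realType) (n : nat) : (0 < n)%N ->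
  full_lattice_polytope
    (convex_hull [set` [:: 0; const_mx n%:R : 'rV[R]_1]])
    (fun t => n * t + 1)%N.
Proof.
move=> n0; have nR0 : 0 < n%:R :> R by rewrite ltr0n.
set s := [:: _; _]; have s0 : 0 \in s by rewrite inE eqxx.
have sn : const_mx n%:R \in s by rewrite !inE eqxx orbT.
have hullE : convex_hull [set` s] = [set x : 'rV[R]_1 | 0 <= x 0 0 <= n%:R].
  apply/seteqP; split.
    apply: smallest_sub => [|x].
      apply/convex_setE => x y t /andP[t0 t1] /andP[x0 x1] /andP[y0 y1] /=.
      by rewrite !mxE; apply/andP; split; nra.
    by rewrite /= !inE => /orP[] /eqP-> /=; rewrite mxE ?lexx ler0n.
  move=> x /= /andP[x0 xn] C [/convex_setE cC sC].
  have -> : x = (x 0 0 / n%:R) *: const_mx n%:R + (1 - x 0 0 / n%:R) *: 0.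
    apply/rowP => i; rewrite !mxE ord1 mulr0 addr0 mulfVK //; exact: lt0r_neq0.
  apply: cC; [|exact: sC|exact: sC].
  by rewrite divr_ge0 ?ler0n //= ler_pdivrMr // mul1r.
split.
- exists s => // v; rewrite !inE => /orP[] /eqP-> i; rewrite mxE //.
- apply/affine_hull_setT => C aC PC; apply/seteqP; split=> // x _.
  have sC v : v \in s -> C v by move=> vs; apply: PC; apply: sub_gen_smallest.
  have -> : x = (x 0 0 / n%:R) *: const_mx n%:R + 0 *: 0.
    apply/rowP => i; rewrite !mxE ord1 mulr0 addr0 mulfVK //; exact: lt0r_neq0.
  by apply: affine_set_span => //; apply: sC.
- move=> t t0; have tR0 : 0 < t%:R :> R by rewrite ltr0n.
  exists [seq const_mx z%:R | z <- iota 0 (n * t + 1)]; split.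
  + rewrite map_inj_uniq ?iota_uniq // => a b /matrixP/(_ 0 0).
    by rewrite !mxE => /eqP; rewrite eqr_nat => /eqP.
  + by rewrite size_map size_iota.
  + rewrite /lattice_points hullE; apply/seteqP; split=> y /=.
      move=> [[x /andP[x0 xn] <-] yint]; have /natrP[z zE] :
          (t%:R *: x) 0 0 \is a Num.nat.
        by rewrite natrEint yint mxE mulr_ge0 // ltW.
      apply/mapP; exists z; last first.
        by apply/rowP => i; rewrite ord1 zE mxE.
      rewrite mem_iota /= add0n addn1 ltnS -(ler_nat R) -zE mxE natrM mulrC.
      by rewrite ler_pM2r.
    move=> /mapP[z]; rewrite mem_iota add0n addn1 ltnS => /= zn ->; split.
      exists (const_mx (z%:R / t%:R)).
        by rewrite mxE divr_ge0 ?ler0n //= ler_pdivrMr // -natrM ler_nat.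
      by apply/rowP => i; rewrite !mxE mulrC mulfVK // lt0r_neq0.
    by move=> i; rewrite mxE.
Qed.

Lemma cube_polytope (R : realType) (n N : nat) : (0 < n)%N ->
  exists P : set 'rV[R]_N,
    full_lattice_polytope P (fun t => (n * t + 1) ^ N)%N.
Proof.
move=> n0; elim: N => [|N [Q Qpoly]].
  (* The space of dimension 0 is a single point, which is the one lattice point of every dilate. *)
  have all0 (x : 'rV[R]_0) : x = 0 by apply/rowP => -[].
  have hullE : convex_hull [set` [:: 0 : 'rV[R]_0]] = setT.
    apply/seteqP; split=> // x _; rewrite (all0 x).
    by apply: sub_gen_smallest; rewrite /= inE.
  exists setT; split.
  - by exists [:: 0] => // v _ [].
  - by apply/affine_hull_setT => C _ TC; apply/seteqP; split=> // x _; apply: TC.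
  - move=> t t0; exists [:: 0]; split=> //.
    apply/seteqP; split=> x _ /=; first by rewrite (all0 x) inE.
    by split=> [|[]//]; exists x; rewrite // (all0 (_ *: _)) (all0 x).
exists (product_set (convex_hull [set` [:: 0; const_mx n%:R : 'rV[R]_1]]) Q).
have -> : (fun t => (n * t + 1) ^ N.+1)%N =
    (fun t => (n * t + 1) * (n * t + 1) ^ N)%N.
  by apply/funext => t; rewrite expnS.
exact: (full_lattice_polytope_product (interval_polytope R n0) Qpoly).
Qed.

(** * The Reeve tetrahedron *)

(** The lattice points with [x + y < n]: the bound is strict, so [n] counts the points on a side and
    [n = 0] gives nothing. *)
Definition triangle_seq (n : nat) : seq (nat * nat) :=
  [seq (x, y) | x <- iota 0 n, y <- iota 0 (n - x)].

Definition tetrahedron_seq (n : nat) : seq (nat * (nat * nat)) :=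
  [seq (q, p) | q <- iota 0 n, p <- triangle_seq (n - q)].

Lemma sumn_sub_recl (f : nat -> nat) (n : nat) :
  sumn [seq f (n.+1 - x)%N | x <- iota 0 n.+1] =
  (f n.+1 + sumn [seq f (n - x)%N | x <- iota 0 n])%N.
Proof. by rewrite /= subn0 (iotaDl 1 0) -map_comp. Qed.

Lemma size_triangle_seq (n : nat) : (2 * size (triangle_seq n) = n * n.+1)%N.
Proof.
rewrite size_allpairs_dep; under eq_map do rewrite size_iota.
by elim: n => [//|n IHn]; rewrite (sumn_sub_recl id) mulnDr IHn /=; lia.
Qed.

Lemma size_tetrahedron_seq (n : nat) :
  (6 * size (tetrahedron_seq n) = n * n.+1 * n.+2)%N.
Proof.
rewrite size_allpairs_dep.
elim: n => [//|n IHn].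
rewrite (sumn_sub_recl (fun x => size (triangle_seq x))) mulnDr IHn.
by have := size_triangle_seq n.+1; nia.
Qed.

Lemma tetrahedron_seq_uniq (n : nat) : uniq (tetrahedron_seq n).
Proof.
apply: allpairs_uniq_dep => [|q _|]; [exact: iota_uniq| |].
  apply: allpairs_uniq_dep => [|x _|]; [exact: iota_uniq|exact: iota_uniq|].
  by move=> [x y] [x' y'] _ _ /= [-> ->].
by move=> [x y] [x' y'] _ _ /= [-> ->].
Qed.

Lemma mem_tetrahedron_seq (n q x y : nat) :
  ((q, (x, y)) \in tetrahedron_seq n) = (q + x + y < n)%N.
Proof.
apply/allpairsPdep/idP => [[q' [[x' y'] [+ /allpairsPdep[x'' [y'' []]]]]]|qxy].
  by rewrite !mem_iota => + + + [? ?] [? ? ?]; subst; lia.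
exists q, (x, y); rewrite mem_iota; split=> //; first by lia.
by apply/allpairsPdep; exists x, y; rewrite !mem_iota; split=> //; lia.
Qed.

(** Lattice points of the [s]-fold tetrahedron, grouped by the residue [r] of the third coordinate
    modulo [m]: for fixed [r], the slices at heights [q m + r] stack up to a discrete tetrahedron.
    For [s = 0] and [r > 0] the truncated side is 0, as it should be. *)
Definition reeve_seq (m s : nat) : seq (nat * nat * nat) :=
  [seq ((p.1 + (0 < r) + p.2.1, p.1 + (0 < r) + p.2.2, p.1 * m + r)%N)
  | r <- iota 0 m, p <- tetrahedron_seq (s.+1 - 2 * (0 < r)%N)].

(** One tetrahedral number of side [s.+1] for the residue 0, and one of side [s.-1] for each of the
    [m.-1] others; the factor 6 clears denominators. *)
Lemma size_reeve_seq (m s : nat) : (0 < m)%N ->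
  (6 * size (reeve_seq m s) =
   s.+1 * s.+2 * s.+3 + m.-1 * (s.-1 * s * s.+1))%N.
Proof.
case: m => // m _; rewrite size_allpairs_dep.
rewrite -[iota 0 m.+1]/(0%N :: iota 1 m) map_cons.
rewrite -[sumn (_ :: _)]/(_ + sumn _)%N.
rewrite [(2 * _)%N]/= subn0.
have -> : [seq size (tetrahedron_seq (s.+1 - 2 * (0 < x)%N)) | x <- iota 1 m] =
    [seq size (tetrahedron_seq s.-1) | x <- iota 1 m].
  apply/eq_in_map => x; rewrite mem_iota => /andP[-> _].
  by congr (size (tetrahedron_seq _)); lia.
have -> (c : nat) : sumn [seq c | x <- iota 1 m] = (m * c)%N.
  by elim: m 1%N => //= m IHm i; rewrite IHm mulSn.
rewrite mulnDr mulnCA !size_tetrahedron_seq.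
by case: s => [|s].
Qed.

(** The third coordinate determines [r] and [q] by division by [m]; the other two then determine [x]
    and [y]. *)
Lemma reeve_seq_uniq (m s : nat) : (0 < m)%N -> uniq (reeve_seq m s).
Proof.
move=> m0; apply: allpairs_uniq_dep => [|r _|]; first exact: iota_uniq.
  exact: tetrahedron_seq_uniq.
move=> u v /allpairsPdep[r [[q [x y]] [+ _ ->]]].
move=> + /allpairsPdep[r' [[q' [x' y']] [+ _ ->]]] => /=.
rewrite !mem_iota /= add0n => rm r'm [ax ay az].
have rr' : r = r'.
  by rewrite -(modn_small rm) -(modn_small r'm) -(modnMDl q) az modnMDl.
subst r'; have qq' : q = q'.
  by apply/eqP; rewrite -(eqn_pmul2r m0); apply/eqP; lia.
have xx' : x = x' by lia.
have yy' : y = y' by lia.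
by subst.
Qed.

(* At height [c = q m + r], the slice of the dilated tetrahedron is a standard
   triangle of size [s - q], translated by [(q, q)], if [r = 0], and its
   lattice points are those of one of size [s - q - 2], translated by
   [(q + 1, q + 1)], otherwise. *)
Lemma mem_reeve_seq (m s a b c : nat) : (0 < m)%N ->
  ((a, b, c) \in reeve_seq m s) =
  [&& c <= m * a, c <= m * b & m * a + m * b <= m * s + c]%N.
Proof.
move=> m0; apply/allpairsPdep/idP.
  move=> [r [[q [x y]] [+ + /= [-> -> ->]]]].
  rewrite mem_iota mem_tetrahedron_seq /= add0n => rm.
  by case: r rm => [|r] rm /= qxy; apply/and3P; split; nia.
move=> /and3P[ca cb abc].
(* [q + e] is [c / m] rounded up, the least value that the first two inequalities allow for [a] and
   [b]. *)
pose q := (c %/ m)%N; pose r := (c %% m)%N; pose e : nat := (0 < r)%N.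
have rm : (r < m)%N by rewrite ltn_mod.
have cE : c = (q * m + r)%N by rewrite -divn_eq.
have qe1 : (q + e <= a)%N.
  by rewrite /e; case: (r) cE ca => [|?] /=; nia.
have qe2 : (q + e <= b)%N.
  by rewrite /e; case: (r) cE cb => [|?] /=; nia.
exists r, (q, (a - (q + e), b - (q + e)))%N; rewrite mem_iota mem_tetrahedron_seq.
split=> //=; last by congr (_, _, _); rewrite -?/e; lia.
(* As [r < m], the third inequality yields [m (a + b) < m (s + q + 1)]. *)
rewrite -/e; suff : (a + b <= s + q)%N by lia.
by rewrite -ltnS -(ltn_pmul2l m0); nia.
Qed.

(** * The tetrahedron as a real polytope *)

Definition row3 (R : Type) (a b c : R) : 'rV[R]_3 :=
  \row_i tnth [tuple a; b; c] i.

Lemma row3_ext (R : Type) (x y : 'rV[R]_3) :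
  (forall i, (i < 3)%N -> x ord0 (inord i) = y ord0 (inord i)) -> x = y.
Proof.
by move=> xy; apply/rowP => i; have := xy i (ltn_ord i); rewrite inord_val.
Qed.

Lemma row3E (R : Type) (a b c : R) :
  (row3 a b c ord0 (inord 0) = a) * (row3 a b c ord0 (inord 1) = b) *
  (row3 a b c ord0 (inord 2) = c).
Proof. by rewrite !mxE !(tnth_nth a) !inordK. Qed.

Definition reeve_vertices (R : realType) (m k : nat) : seq 'rV[R]_3 :=
  [:: 0; row3 k%:R 0 0; row3 0 k%:R 0; row3 k%:R k%:R (k * m)%:R].

(** The facet inequalities, cleared of denominators. The size [s] is real, so that the family is
    closed under dilation. *)
Definition reeve_set (R : realType) (m : nat) (s : R) : set 'rV[R]_3 :=
  [set x | let a := x ord0 (inord 0) in let b := x ord0 (inord 1) in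
           let c := x ord0 (inord 2) in
    [/\ 0 <= c, c <= m%:R * a, c <= m%:R * b &
        m%:R * a + m%:R * b <= m%:R * s + c]].

(** Barycentric coordinates with respect to the four vertices, valid for every point of the space;
    they serve both the convex and the affine hull. *)
Lemma reeve_row3E (R : realType) (m k : nat) (x : 'rV[R]_3) :
  (0 < m)%N -> (0 < k)%N ->
  let a := x ord0 (inord 0) in let b := x ord0 (inord 1) in
  let g := x ord0 (inord 2) / (k%:R * m%:R) in
  x = (1 - a / k%:R - b / k%:R + g) *: 0 + (a / k%:R - g) *: row3 k%:R 0 0 +
    ((b / k%:R - g) *: row3 0 k%:R 0 + g *: row3 k%:R k%:R (k * m)%:R).
Proof.
rewrite -(ltr0n R) => m0; rewrite -(ltr0n R) => k0 a b g.
have mN0 := lt0r_neq0 m0; have kN0 := lt0r_neq0 k0.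
by apply: row3_ext => -[|[|[|//]]] _;
  rewrite !mxE !(tnth_nth 0) !inordK //= ?natrM /g /a /b;
  field; rewrite ?mN0 ?kN0.
Qed.

(** Up to positive factors, the facet inequalities say that the barycentric coordinates are
    nonnegative. *)
Lemma convex_hull_reeve (R : realType) (m k : nat) : (0 < m)%N -> (0 < k)%N ->
  convex_hull [set` reeve_vertices R m k] = @reeve_set R m k%:R.
Proof.
move=> m0 k0; apply/seteqP; split.
  apply: smallest_sub => [|x].
    apply/convex_setE => x y t /andP[t0 t1] [x1 x2 x3 x4] [y1 y2 y3 y4].
    rewrite /reeve_set /= !mxE.
    by split; nra.
  have mk0 : 0 <= m%:R * k%:R :> R by rewrite mulr_ge0.
  rewrite /reeve_set /= !inE => /or4P[] /eqP->; rewrite ?row3E ?mxE ?natrM;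
    by split; lra.
move=> x [x1 x2 x3 x4] C [cC sC].
have mR0 : 0 < m%:R :> R by rewrite ltr0n.
have kR0 : 0 < k%:R :> R by rewrite ltr0n.
have kmR0 : 0 < k%:R * m%:R :> R by rewrite mulr_gt0.
rewrite (reeve_row3E x m0 k0).
apply: convex_comb4 => //; try by apply: sC; rewrite /= !inE eqxx ?orbT.
- rewrite -(pmulr_rge0 _ kmR0); have -> : forall a b c : R,
    k%:R * m%:R * (1 - a / k%:R - b / k%:R + c / (k%:R * m%:R)) =
    m%:R * k%:R + c - (m%:R * a + m%:R * b).
    by move=> a b c; field; rewrite !lt0r_neq0.
  by rewrite subr_ge0.
- rewrite subr_ge0 ler_pdivrMr // mulrA mulfVK ?lt0r_neq0 // mulrC //.
- rewrite subr_ge0 ler_pdivrMr // mulrA mulfVK ?lt0r_neq0 // mulrC //.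
- by rewrite divr_ge0 // ltW.
- by ring.
Qed.

Lemma affine_hull_reeve (R : realType) (m k : nat) : (0 < m)%N -> (0 < k)%N ->
  affine_hull (convex_hull [set` reeve_vertices R m k]) = setT.
Proof.
move=> m0 k0; apply/affine_hull_setT => C aC PC; apply/seteqP; split=> // x _.
have sC v : v \in reeve_vertices R m k -> C v.
  by move=> vs; apply: PC; apply: sub_gen_smallest.
have C0 : C 0 by apply: sC; rewrite inE eqxx.
rewrite (reeve_row3E x m0 k0) -[X in C X]scale1r scalerDr.
by apply: affine_set_span => //; apply: affine_set_span => //;
  apply: sC; rewrite !inE eqxx ?orbT.
Qed.

Lemma dilate_reeve_set (R : realType) (m : nat) (s t : R) : 0 < t ->
  [set t *: x | x in reeve_set m s] = reeve_set m (t * s).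
Proof.
move=> t0.
have sub (e s' : R) (x : 'rV[R]_3) : 0 < e ->
    reeve_set m s' x -> reeve_set m (e * s') (e *: x).
  move=> e0; rewrite /reeve_set /= !mxE ![m%:R * (e * _)]mulrCA -!mulrDr.
  by rewrite !(ler_pM2l e0) pmulr_rge0.
apply/seteqP; split=> [_ [x xs <-]|y ys]; first exact: sub.
exists (t^-1 *: y); last by rewrite scalerA divff ?scale1r ?lt0r_neq0.
by rewrite -[s](mulKf (lt0r_neq0 t0)); apply: sub; rewrite ?invr_gt0.
Qed.

Lemma reeve_polytope (R : realType) (m k : nat) : (0 < m)%N -> (0 < k)%N ->
  full_lattice_polytope (convex_hull [set` reeve_vertices R m k])
    (fun t => size (reeve_seq m (k * t))).
Proof.
move=> m0 k0; split.
- exists (reeve_vertices R m k) => // v.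
  by rewrite !inE => /or4P[] /eqP-> i; rewrite !mxE //;
    case: i => -[|[|[|//]]] i3; rewrite ?(tnth_nth 0) /=.
- exact: affine_hull_reeve.
- move=> t t0; have tR0 : 0 < t%:R :> R by rewrite ltr0n.
  exists [seq row3 p.1.1%:R p.1.2%:R p.2%:R | p <- reeve_seq m (k * t)]; split.
  + rewrite map_inj_uniq ?reeve_seq_uniq // => -[[a b] c] [[a' b'] c'] /= E.
    have inj i : (row3 a%:R b%:R c%:R : 'rV[R]_3) ord0 (inord i) =
        row3 a'%:R b'%:R c'%:R ord0 (inord i) by rewrite E.
    have := inj 0; have := inj 1; have := inj 2.
    rewrite !row3E => /eqP + /eqP + /eqP.
    by rewrite !eqr_nat => /eqP-> /eqP-> /eqP->.
  + by rewrite size_map.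
  + rewrite /lattice_points convex_hull_reeve // dilate_reeve_set // -natrM.
    rewrite mulnC; apply/seteqP; split=> y /=.
      move=> [[c0 ca cb abc] yint].
      have mR0 : 0 < m%:R :> R by rewrite ltr0n.
      have nat_of (i : 'I_3) : 0 <= y ord0 i -> exists n, y ord0 i = n%:R.
        by move=> yi; apply/natrP; rewrite natrEint yint.
      have [c cE] := nat_of _ c0.
      (* Nonnegativity of this coordinate is not a facet inequality, but follows from
         [0 <= c <= m a]. *)
      have [a aE] : exists n, y ord0 (inord 0) = n%:R.
        by apply: nat_of; rewrite -(pmulr_rge0 _ mR0); apply: le_trans ca.
      have [b bE] : exists n, y ord0 (inord 1) = n%:R.
        by apply: nat_of; rewrite -(pmulr_rge0 _ mR0); apply: le_trans cb.
      apply/mapP; exists (a, b, c); last first.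
        by apply: row3_ext => -[|[|[|//]]] _; rewrite row3E.
      move: ca cb abc; rewrite aE bE cE -!natrM -!natrD !ler_nat => ca cb abc.
      by rewrite mem_reeve_seq // ca cb abc.
    move=> /mapP[[[a b] c]]; rewrite mem_reeve_seq // => /and3P[ca cb abc] -> /=.
    split.
      by rewrite /reeve_set /= !row3E -!natrM -!natrD !ler_nat ler0n.
    by move=> i; rewrite mxE; case: i => -[|[|[|//]]] i3; rewrite ?(tnth_nth 0) /=.
Qed.

(** * Signs of the coefficients *)

Definition reeve_poly (R : realType) (m k : nat) : {poly R} :=
  1 + (k%:R * (2 - m%:R / 6)) *: 'X + (k%:R ^+ 2) *: 'X^2 +
  (k%:R ^+ 3 * (m%:R / 6)) *: 'X^3.

Lemma horner_reeve_poly (R : realType) (m k t : nat) : (0 < m)%N ->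
  (reeve_poly R m k).[t%:R] = (size (reeve_seq m (k * t)))%:R.
Proof.
move=> m0; have := size_reeve_seq (k * t) m0.
(* The truncated predecessor at [s = 0] is harmless, since the factor [s] vanishes there. *)
have pred3 s : (s.-1 * s * s.+1)%:R = (s%:R - 1) * s%:R * (s%:R + 1) :> R.
  by case: s => [|s]; rewrite ?mulr0 ?mul0r //= !natrM -!natr1; ring.
have succ3 s : (s.+1 * s.+2 * s.+3)%:R =
    (s%:R + 1) * (s%:R + 2) * (s%:R + 3) :> R.
  by rewrite -(addn3 s) -(addn2 s) -(addn1 s) !natrM !natrD.
move/(congr1 (fun x => x%:R : R)).
rewrite natrM natrD [(m.-1 * _)%:R]natrM pred3 succ3 => sizeE.
have mE : m%:R = (m.-1)%:R + 1 :> R by rewrite natr1 prednK.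
apply: (@mulfI _ 6) => //; rewrite sizeE /reeve_poly -(polyC1 R) mE.
by rewrite !(hornerD, hornerZ, hornerX, hornerXn, hornerC) natrM; field.
Qed.

(** * Coefficients of the cube factor *)

Lemma coef_linear_exp (R : comNzRingType) (a : R) (N i : nat) :
  ((1 + a *: 'X : {poly R}) ^+ N)`_i = 'C(N, i)%:R * a ^+ i.
Proof.
rewrite exprDn coef_sum.
under eq_bigr => j _ do rewrite expr1n mul1r exprZn coefMn coefZ coefXn.
have [iN|Ni] := ltnP i N.+1; last first.
  rewrite bin_small // mul0r big1 // => j _.
  by rewrite gtn_eqF ?mulr0 ?mul0rn //; apply: leq_trans Ni.
rewrite (bigD1 (Ordinal iN)) //= eqxx mulr1 big1 ?addr0 ?mulr_natl // => j ji.
by rewrite eq_sym (negbTE (_ : j != i :> nat)) ?mulr0 ?mul0rn.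
Qed.

(** The coefficient of [t^i] in [(1 + N t)^N], the counting polynomial of the cube of side [N]. *)
Definition weighted_bin (N i : nat) : nat := ('C(N, i) * N ^ i)%N.

(** The ratio of consecutive terms is [N (N - i) / (i + 1)], which decreases in [i] and is [N^2] at
    [i = 0]. *)
Lemma weighted_bin_succ (N i : nat) :
  (weighted_bin N i.+1 <= N ^ 2 * weighted_bin N i)%N.
Proof.
have := mul_bin_left N i.
rewrite /weighted_bin expnS; set a := 'C(N, i); set b := 'C(N, i.+1) => ab.
have ba : (b <= N * a)%N by nia.
have -> : (N ^ 2 * (a * N ^ i) = N * a * (N * N ^ i))%N by ring.
by rewrite leq_mul.
Qed.

(** The same ratio is least at the last admissible index [i = N - 2], where equality holds. *)
Lemma weighted_bin_pred (N i : nat) : (i.+1 < N)%N ->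
  (2 * N * weighted_bin N i <= (N - 1) * weighted_bin N i.+1)%N.
Proof.
move=> iN; have := mul_bin_left N i.
rewrite /weighted_bin expnS; set a := 'C(N, i); set b := 'C(N, i.+1) => ab.
have ab' : (2 * a <= (N - 1) * b)%N by nia.
have -> : (2 * N * (a * N ^ i) = 2 * a * (N * N ^ i))%N by ring.
by rewrite [leqRHS]mulnA leq_mul.
Qed.

(** The product of two consecutive ratios is least at [i = N - 3], again with equality. *)
Lemma weighted_bin_pred2 (N i : nat) : (i.+2 < N)%N ->
  (6 * N ^ 2 * weighted_bin N i <= (N - 1) * (N - 2) * weighted_bin N i.+2)%N.
Proof.
move=> iN; have := mul_bin_left N i; have := mul_bin_left N i.+1.
rewrite /weighted_bin !expnS expn0 muln1.
set a := 'C(N, i); set b := 'C(N, i.+1); set c := 'C(N, i.+2) => bc ab.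
have bc' : (i.+2 * (i.+1 * c) = (N - i.+1) * ((N - i) * a))%N.
  by rewrite -ab mulnCA bc mulnCA.
have ac : (6 * a <= (N - 1) * (N - 2) * c)%N.
  apply: (@leq_trans ((N - i.+1) * ((N - i) * a))); first by nia.
  by rewrite -bc' mulnA leq_mul //; nia.
have -> : (6 * (N * N) * (a * N ^ i) = 6 * a * (N * (N * N ^ i)))%N by ring.
by rewrite [leqRHS]mulnA leq_mul.
Qed.

(** * Coefficients of the product *)

Definition reeve_cube_poly (R : realType) (m k n N : nat) : {poly R} :=
  (1 + n%:R *: 'X) ^+ N * reeve_poly R m k.

(** The matches drop the terms of negative index, for which truncated subtraction would wrongly give
    [g 0]. *)
Lemma coef_reeve_cube_poly (R : realType) (m k N j : nat) :
  let g i : R := (weighted_bin N i)%:R in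
  (reeve_cube_poly R m k N N)`_j.+1 =
  g j.+1 + k%:R * (2 - m%:R / 6) * g j +
  (if j is i.+1 then k%:R ^+ 2 * g i else 0) +
  (if j is i.+2 then k%:R ^+ 3 * (m%:R / 6) * g i else 0).
Proof.
have gE i : ((1 + N%:R *: 'X : {poly R}) ^+ N)`_i = (weighted_bin N i)%:R.
  by rewrite coef_linear_exp -natrX -natrM.
rewrite /= /reeve_cube_poly /reeve_poly.
move: (_ * _) (_ ^+ 2) (_ ^+ 3 * _) => a b c.
rewrite !mulrDr mulr1 -!scalerAr !coefD !coefZ coefMX !coefMXn gE.
case: j => [|[|j]] /=; rewrite ?mulr0 ?addr0 !gE ?addr0 //.
by rewrite !subSS !subn0.
Qed.

Lemma reeve_cube_poly_top_gt0 (R : realType) (N : nat) : (0 < N)%N ->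
  0 < (reeve_cube_poly R (72 * N ^ 2 - 54) 2 N N)`_N.+1.
Proof.
move=> N0; rewrite coef_reeve_cube_poly.
have -> : (72 * N ^ 2 - 54)%:R = 72 * N%:R ^+ 2 - 54 :> R.
  rewrite natrB ?natrM ?natrX //.
  by have : (0 < N ^ 2)%N by [rewrite expn_gt0 N0]; lia.
have -> : weighted_bin N N.+1 = 0%N by rewrite /weighted_bin bin_small.
have -> : weighted_bin N N = (N ^ N)%N by rewrite /weighted_bin binn mul1n.
have xN : 0 < (N ^ N)%:R :> R by rewrite ltr0n expn_gt0 N0.
case: N N0 xN => [//|[|N]] _ xN.
  (* For [N = 1], [m = 18] and the coefficient is [2 (2 - 3) + 4 = 2]. *)
  rewrite /weighted_bin bin0 /= !exp1n muln1; lra.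
have -> : weighted_bin N.+2 N.+1 = (N.+2 ^ N.+2)%N.
  by rewrite /weighted_bin binSn !expnS.
have : 2 * N.+2%:R * (weighted_bin N.+2 N)%:R =
    (N.+2%:R - 1) * (N.+2 ^ N.+2)%:R :> R.
  rewrite -[X in X - 1]natr1 addrK -!natrM; congr _%:R; rewrite /weighted_bin !expnS.
  have := mul_bin_left N.+2 N; rewrite binSn; nia.
have : 2 <= N.+2%:R :> R by rewrite ler_nat.
move: (N.+2 ^ N.+2)%:R xN (weighted_bin _ _)%:R N.+2%:R => e e0 w x x2 wx.
rewrite -(pmulr_rgt0 _ (lt_le_trans (ltr0n R 2) x2)).
set lhs := (X in 0 < X).
have -> : lhs = x * (0 + 2 * (2 - (72 * x ^+ 2 - 54) / 6) * e + 2 ^+ 2 * e) +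
    4 * ((72 * x ^+ 2 - 54) / 6) * (2 * x * w) by rewrite /lhs; ring.
rewrite wx (_ : _ + _ = (24 * x ^+ 3 - 48 * x ^+ 2 - 10 * x + 36) * e).
  (* The cubic equals [(x - 2) (24 x^2 - 10) + 16]. *)
  have x_ge2 : 0 <= (x - 2) * (24 * x ^+ 2 - 10) by rewrite mulr_ge0 //; nra.
  by rewrite mulr_gt0 //; lra.
by field.
Qed.

(* With [x = N] and [g = weighted_bin N j], the bounds on the neighbouring
   weighted binomials reduce the claim to
   [21 x^4 + 144 x^3 - 132 x^2 - 102 x + 72 > 0] for [x >= 1], which is made
   apparent by expanding at [x = 1]. *)
Lemma reeve_cube_poly_coef_lt0 (R : realType) (N j : nat) : (j < N)%N ->
  (reeve_cube_poly R (72 * N ^ 2 - 54) 2 N N)`_j.+1 < 0.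
Proof.
move=> jN; have N0 : (0 < N)%N by apply: leq_ltn_trans jN.
rewrite coef_reeve_cube_poly.
have -> : (72 * N ^ 2 - 54)%:R = 72 * N%:R ^+ 2 - 54 :> R.
  rewrite natrB ?natrM ?natrX //.
  by have : (0 < N ^ 2)%N by [rewrite expn_gt0 N0]; lia.
have x1 : 1 <= N%:R :> R by rewrite ler1n.
have g0 : 0 < (weighted_bin N j)%:R :> R.
  by rewrite ltr0n muln_gt0 bin_gt0 (ltnW jN) expn_gt0 N0.
have : (weighted_bin N j.+1)%:R <= N%:R ^+ 2 * (weighted_bin N j)%:R :> R.
  by rewrite -natrX -natrM ler_nat weighted_bin_succ.
set b : R := if j is i.+1 then _ else 0.
set c : R := if j is i.+2 then _ else 0.
have : 2 * N%:R * b <= 4 * (N%:R - 1) * (weighted_bin N j)%:R.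
  rewrite /b; case: (j) jN => [|i] iN.
    by rewrite mulr0 !mulr_ge0 ?subr_ge0.
  have := weighted_bin_pred iN; rewrite -(ler_nat R) !natrM natrB //; lra.
have : 6 * N%:R ^+ 2 * c <=
    8 * (12 * N%:R ^+ 2 - 9) * ((N%:R - 1) * (N%:R - 2)) * (weighted_bin N j)%:R.
  have x9 : 0 <= 8 * (12 * N%:R ^+ 2 - 9) :> R by nra.
  (* Integrality of [N] matters: the product is negative strictly between 1 and 2. *)
  have x12 : 0 <= (N%:R - 1) * (N%:R - 2) :> R.
    case: (N) N0 => [//|[|n]] _; first by rewrite subrr mul0r.
    by rewrite mulr_ge0 // subr_ge0 ?ler1n // ler_nat.
  rewrite /c; case: (j) jN => [|[|i]] iN /=;
    try by rewrite mulr0 mulr_ge0 // mulr_ge0.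
  have := weighted_bin_pred2 iN.
  rewrite -(ler_nat R) !natrM natrX !natrB ?(leq_trans _ iN) //.
  move=> /(ler_wpM2l x9); lra.
move: (weighted_bin N j)%:R (weighted_bin N j.+1)%:R N%:R x1 b c g0.
move=> g g' x x1 b c g0 c_le b_le g'_le.
(* The factor [6 x^2] clears the denominators in the bounds on [b] and [c]. *)
rewrite -(pmulr_rlt0 _ (_ : 0 < 6 * x ^+ 2)); last by nra.
have y0 : 0 <= x - 1 by rewrite subr_ge0.
have : 0 < g * (3 + 150 * (x - 1) + 426 * (x - 1) ^+ 2 + 228 * (x - 1) ^+ 3 +
    21 * (x - 1) ^+ 4).
  by rewrite mulr_gt0 // -!addrA ltr_pwDl // !addr_ge0 // mulr_ge0 // exprn_ge0.
have x2 : 0 <= 6 * x ^+ 2 by nra.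
have x3 : 0 <= 3 * x by lra.
move: (ler_wpM2l x2 g'_le) (ler_wpM2l x3 b_le); lra.
Qed.

(** * The polytopes and the choice of parameters *)

Lemma reeve_cube_exists (R : realType) (m k n N : nat) :
  (0 < m)%N -> (0 < k)%N -> (0 < n)%N ->
  exists P : set 'rV[R]_(3 + N),
    [/\ integral_polytope P, has_dimension P (3 + N) &
        ehrhart_polynomial P (reeve_cube_poly R m k n N)].
Proof.
move=> m0 k0 n0; have [Q Qpoly] := cube_polytope R N n0.
have [intP dimP countP] := full_lattice_polytopeP
  (full_lattice_polytope_product (reeve_polytope R m0 k0) Qpoly).
eexists; split; [exact: intP|exact: dimP|] => t t0.
rewrite countP // natrM hornerM horner_reeve_poly // mulrC natrX natrD natrM.
by rewrite horner_exp hornerD hornerZ hornerX -(polyC1 R) hornerC addrC.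
Qed.

Theorem theorem3p2 (R : realType) (d : nat) (hd : (3 <= d)%N) :
  exists (N : nat) (P : set 'rV[R]_N),
    integral_polytope P /\ has_dimension P d /\
    exists p : {poly R},
      ehrhart_polynomial P p /\
      0 < p`_(d - 2) /\
      (forall j : nat, (1 <= j < d - 2)%N -> p`_j < 0).
Proof.
rewrite -(subnKC hd); set N := (d - 3)%N.
have -> : (3 + N - 2 = N.+1)%N by lia.
have [->|N0] := posnP N.
  (* For [d = 3] no coefficient has to be negative, and that of [t] is [2 - 1/6]. *)
  have [P [intP dimP ehrP]] := @reeve_cube_exists R 1 1 1 0 isT isT isT.
  exists (3 + 0)%N, P; do 2!split=> //.
  exists (reeve_cube_poly R 1 1 1 0); split=> //; split=> [|[|j]] //.
  rewrite /reeve_cube_poly expr0 mul1r /reeve_poly.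
  by rewrite !coefD !coefZ coef1 coefX !coefXn /=; lra.
have m0 : (0 < 72 * N ^ 2 - 54)%N.
  by have : (0 < N ^ 2)%N by [rewrite expn_gt0 N0]; lia.
have [P [intP dimP ehrP]] := @reeve_cube_exists R _ 2 N N m0 isT N0.
exists (3 + N)%N, P; do 2!split=> //.
exists (reeve_cube_poly R (72 * N ^ 2 - 54) 2 N N); split=> //; split.
  exact: reeve_cube_poly_top_gt0.
by move=> [|j] // /andP[_ jN]; apply: reeve_cube_poly_coef_lt0.
Qed.
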